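(* Let $N\ge 2$ and let $f(\theta)=\sum_{n=0}^N a_n\cos(n\theta)$ be a non-negative trigonometric polynomial of degree $N$, i.e. the $a_n$ are real, $a_0>0$, $a_N\neq 0$, and $f(\theta)\ge 0$ for all real $\theta$. Suppose that (I) $a_1>0$; (II) $\sum_{n=0}^N |a_n|\le 2a_1$; (III) $a_n\ge 0$ for all $n\ge 2$. Then $N$ is even and $$\frac{a_0}{a_1}\ge \frac34 .$$ Moreover, the value $a_0/a_1=3/4$ is attained by such a polynomial if and only if $f$ is a positive scalar multiple of the classical polynomial $3+4\cos(\theta)+\cos(2\theta)$.
   Context: Motivation (not needed for the claim): for $\sigma>1$, such a polynomial yields the bound $|\zeta(\sigma+it)|^{-1}\le\big(\zeta(\sigma)^{a_0}|\zeta(\sigma+2it)|^{a_2}\cdots|\zeta(\sigma+Nit)|^{a_N}\big)^{1/a_1}$, and one wishes to minimize the exponent $a_0/a_1$ of $\zeta(\sigma)$; the theorem says $3+4\cos\theta+\cos 2\theta$ is the unique optimal choice up to scaling. *)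

(* Defs.v *)
From mathcomp Require Import all_boot all_order all_algebra.
From mathcomp Require Import all_classical all_reals all_analysis.

Set Implicit Arguments.
Unset Strict Implicit.
Unset Printing Implicit Defensive.

Import Order.TTheory GRing.Theory Num.Theory.
Import numFieldNormedType.Exports.

Local Open Scope ring_scope.

(* Only the coefficients a 0, ..., a N matter: values of the sequence a beyond
   index N are junk and are never constrained. *)
Definition cos_poly (R : realType) (N : nat) (a : nat -> R) (theta : R) : R :=
  \sum_(0 <= n < N.+1) a n * cos (n%:R * theta).

Definition nonneg_cos_poly (R : realType) (N : nat) (a : nat -> R) : Prop :=
  [/\ 0 < a 0%N, a N != 0 & forall theta : R, 0 <= cos_poly N a theta].

Definition admissible (R : realType) (N : nat) (a : nat -> R) : Prop :=
  [/\ nonneg_cos_poly N a,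
      0 < a 1%N,
      \sum_(0 <= n < N.+1) `|a n| <= 2 * a 1%N
    & forall n : nat, (2 <= n <= N)%N -> 0 <= a n].

Definition classical_poly (R : realType) (theta : R) : R :=
  3 + 4 * cos theta + cos (2 * theta).

(* Main.v *)
(* Condition (II) reads [a_0 + \sum_(n >= 2) a_n <= a_1], while [f(pi) >= 0]
   reads [a_1 <= a_0 + \sum_(n >= 2) (-1)^n a_n]. Hence [a_n = 0] for every odd
   [n >= 3], and [f(pi) = 0] is a minimum of [f]. The second-order condition
   there, [\sum_n (-1)^n n^2 a_n <= 0], becomes
   [\sum_(n >= 2) (n^2 - 4) a_n <= 4 a_0 - 3 a_1], whose left-hand side is a sum
   of nonnegative terms; equality kills every [a_n] with [n >= 3]. The converse
   rests on the uniqueness of the coefficients of a cosine polynomial. *)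

Require Import Defs.
From mathcomp Require Import all_boot all_order all_algebra.
From mathcomp Require Import all_classical all_reals all_analysis.
From mathcomp Require Import ring lra.

Import Order.TTheory GRing.Theory Num.Theory.
Import numFieldNormedType.Exports.

Local Open Scope ring_scope.

Lemma sumr_nat_le0_eq0 (R : numDomainType) (m n : nat) (F : nat -> R) :
  (forall i, (m <= i < n)%N -> 0 <= F i) -> \sum_(m <= i < n) F i <= 0 ->
  forall i, (m <= i < n)%N -> F i = 0.
Proof.
move=> F_ge0 sum_le0 i mi.
have : \sum_(m <= i < n | (m <= i < n)%N) F i == 0.
  by rewrite eq_le -big_nat sum_le0 big_nat sumr_ge0.
rewrite psumr_eq0 // => /allP/(_ i).
by rewrite mem_index_iota mi => /(_ isT)/eqP.
Qed.

(** * Translation by [pi] and uniqueness of coefficients *)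

Lemma cos_natMpiD (R : realType) (n : nat) (x : R) :
  cos (n%:R * (x + pi)) = (-1) ^+ n * cos (n%:R * x).
Proof.
rewrite mulrDr; move: (n%:R * x) => y.
elim: n y => [|n IHn] y; first by rewrite mul0r addr0 mul1r.
by rewrite -natr1 mulrDl mul1r addrA cosDpi IHn exprS mulN1r mulNr.
Qed.

Lemma cos_polyDpi (R : realType) (N : nat) (a : nat -> R) (x : R) :
  cos_poly N a (x + pi) = cos_poly N (fun n => (-1) ^+ n * a n) x.
Proof. by apply: eq_bigr => n _; rewrite cos_natMpiD mulrA [a n * _]mulrC. Qed.

(* Second difference in theta: the [N]-th coefficient is multiplied by
   [cos (N h)], and can thus be cancelled. *)
Lemma cos_poly_eq0 (R : realType) (N : nat) (b : nat -> R) :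
  (forall theta, cos_poly N b theta = 0) -> forall n, (n <= N)%N -> b n = 0.
Proof.
elim: N b => [|N IHN] b b0 n.
  rewrite leqn0 => /eqP->.
  by have := b0 0; rewrite /cos_poly big_nat1 mul0r cos0 mulr1.
have lt_b0 m : (m <= N)%N -> b m = 0.
  (* This [h] gives [cos (N.+1 h) = -1], while [m h] stays in [[0, pi)] for [m <= N]; there [cos]
     exceeds [-1], so the factor on [b m] is nonzero. *)
  move=> lemN; pose h : R := pi / N.+1%:R.
  have /(IHN (fun n => b n * (cos (n%:R * h) - cos (N.+1%:R * h))))/(_ m lemN) :
      forall theta, cos_poly N
        (fun n => b n * (cos (n%:R * h) - cos (N.+1%:R * h))) theta = 0.
    move=> theta; transitivity ((cos_poly N.+1 b (theta + h) +
        cos_poly N.+1 b (theta - h)) / 2 -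
        cos (N.+1%:R * h) * cos_poly N.+1 b theta); last first.
      by rewrite !b0; lra.
    rewrite /cos_poly -big_split mulr_suml mulr_sumr -sumrB.
    rewrite [RHS]big_nat_recr //= addrC -[LHS]add0r; congr (_ + _).
      by rewrite [_ * (theta + h)]mulrDr [_ * (theta - h)]mulrBr cosB cosD; field.
    by apply: eq_bigr => k _; rewrite [_ * (theta + h)]mulrDr [_ * (theta - h)]mulrBr cosB cosD; field.
  have -> : N.+1%:R * h = pi by rewrite /h mulrC divfK // pnatr_eq0.
  move/eqP; rewrite mulf_eq0 => /orP[/eqP//|].
  have N1_gt0 : 0 < N.+1%:R :> R by rewrite ltr0n.
  have m_lt : m%:R < N.+1%:R :> R by rewrite ltr_nat.
  have mh_lt : m%:R * h < pi.
    by rewrite /h mulrA ltr_pdivrMr // mulrC ltr_pM2l ?pi_gt0.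
  rewrite subr_eq0 gt_eqF // ltr_cos // in_itv /= ?pi_ge0 ?lexx //.
  by rewrite (ltW mh_lt) andbT mulr_ge0 ?ler0n // divr_ge0 ?pi_ge0 ?ler0n.
rewrite leq_eqVlt => /orP[/eqP->|]; last exact: lt_b0.
(* With the lower coefficients gone, the value at 0 is the top one. *)
have := b0 0; rewrite /cos_poly big_nat_recr //= mulr0 cos0 mulr1.
rewrite big_nat big1 ?add0r // => k /andP[_ kN].
by rewrite lt_b0 ?mul0r.
Qed.

(** * Second-order condition at a minimum *)

(* [sin (n x) / sin x], extended continuously to the zeros of [sin] *)
Fixpoint dirichlet_ratio (R : realType) (n : nat) (x : R) : R :=
  if n is m.+1 then dirichlet_ratio R m x * cos x + cos (m%:R * x) else 0.

Lemma dirichlet_ratioE (R : realType) (n : nat) (x : R) :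
  sin (n%:R * x) = sin x * dirichlet_ratio R n x.
Proof.
elim: n => [|n IHn]; first by rewrite mul0r sin0 mulr0.
by rewrite -natr1 mulrDl mul1r sinD IHn /=; ring.
Qed.

Lemma dirichlet_ratio0 (R : realType) (n : nat) :
  dirichlet_ratio R n 0 = n%:R.
Proof. by elim: n => //= n ->; rewrite mulr0 cos0 mulr1 natr1. Qed.

Lemma continuous_dirichlet_ratio (R : realType) (n : nat) :
  continuous (dirichlet_ratio R n).
Proof.
elim: n => [|n IHn] x /=; first exact: cvg_cst.
apply: cvgD; first by apply: cvgM; [exact: IHn | exact: continuous_cos].
apply: continuous_cvg; first exact: continuous_cos.
exact: mulrl_continuous.
Qed.

(* Second-order condition at a minimum: divide [c_n (cos (2 n x) - 1)] by
   [2 sin^2 x] and let [x] tend to [0]. *)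
Lemma cos_poly_min0 (R : realType) (N : nat) (c : nat -> R) :
  (forall theta, 0 <= cos_poly N c theta) -> cos_poly N c 0 = 0 ->
  \sum_(0 <= n < N.+1) c n * n%:R ^+ 2 <= 0.
Proof.
move=> c_ge0 c0.
pose G x := \sum_(0 <= n < N.+1) c n * dirichlet_ratio R n x ^+ 2.
have -> : \sum_(0 <= n < N.+1) c n * n%:R ^+ 2 = G 0.
  by apply: eq_bigr => n _; rewrite dirichlet_ratio0.
have G_le0 x : 0 < sin x -> G x <= 0.
  (* Termwise, [cos (2 n x) = 1 - 2 sin^2 (n x)], and [sin x] factors out of [sin (n x)]. *)
  move=> sx; have : cos_poly N c (2 * x) = cos_poly N c 0 - 2 * sin x ^+ 2 * G x.
    rewrite /cos_poly /G mulr_sumr -sumrB; apply: eq_bigr => n _.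
    rewrite mulr0 cos0 [n%:R * _]mulrCA [2 * (_ * x)]mulr_natl cos_mulr2n cos2sin2.
    by rewrite dirichlet_ratioE; ring.
  have := c_ge0 (2 * x); rewrite c0 sub0r => /[swap]->.
  by rewrite oppr_ge0 pmulr_rle0 // mulr_gt0 ?exprn_gt0.
have Gcont : {for 0, continuous G}.
  apply: cvg_big => [|n _]; first exact: add_continuous.
  apply: cvgM; first exact: cvg_cst.
  by apply: cvgM; exact: continuous_dirichlet_ratio.
(* If [G 0 > 0], continuity keeps [G] positive just to the right of 0, where [sin] is positive,
   against [G_le0]. *)
rewrite leNgt; apply/negP => G0_gt0.
have /= : (\forall x \near (0 : R)^'+, 0 < G x)%classic.
  by apply: cvg_within; exact: (cvgr_gt _ Gcont).
move=> G_gt0.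
have [x []] : exists x : R, 0 < sin x /\ 0 < G x.
  near (0 : R)^'+%classic => x; exists x; split; last by near: x.
  apply: sin_gt0_pi; apply/andP; split; first by near: x; exact: nbhs_right_gt.
  by near: x; apply: nbhs_right_lt; exact: pi_gt0.
by move=> /G_le0 Gx /lt_geF; rewrite Gx.
Unshelve. all: by end_near.
Qed.

(** * The classical polynomial *)

Lemma big_nat_recl2 (R : nmodType) (N : nat) (F : nat -> R) : (2 <= N)%N ->
  \sum_(0 <= n < N.+1) F n = F 0%N + F 1%N + \sum_(2 <= n < N.+1) F n.
Proof. by move=> N2; rewrite big_ltn // big_ltn ?addrA // ltnS ltnW. Qed.

(** The default 0 of [nth] pads the coefficients up to any [N], so that they can be compared with
    those of [a]. *)
Lemma classical_polyE (R : realType) (N : nat) (theta : R) : (2 <= N)%N ->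
  classical_poly theta = cos_poly N (nth 0 [:: 3; 4; 1]) theta.
Proof.
move=> N2; rewrite /cos_poly big_nat_recl2 // big_ltn //= big_nat big1 => [|n].
  by rewrite /classical_poly mul0r cos0 mulr1 !mul1r addr0.
by case/andP=> n3 _; rewrite nth_default ?mul0r.
Qed.

(** The polynomial equals [2 (1 + cos theta)^2]. *)
Lemma classical_poly_ge0 (R : realType) (theta : R) : 0 <= classical_poly theta.
Proof.
rewrite /classical_poly [2 * theta]mulr_natl cos_mulr2n.
have := sqr_ge0 (cos theta + 1); lra.
Qed.

(** * Consequences of admissibility *)

Section Admissible.
Variables (R : realType) (N : nat) (a : nat -> R).
Hypotheses (N2 : (2 <= N)%N) (adm : admissible N a).

Lemma admissible_ge0 n : (2 <= n < N.+1)%N -> 0 <= a n.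
Proof. by rewrite ltnS; case: adm => _ _ _; apply. Qed.

Lemma admissible_sum_le : a 0%N + \sum_(2 <= n < N.+1) a n <= a 1%N.
Proof.
case: adm => -[a0 _ _] a1 + _; rewrite big_nat_recl2 //.
rewrite (gtr0_norm a0) (gtr0_norm a1).
rewrite (@eq_big_nat _ _ _ _ _ _ a) => [|n /admissible_ge0 /ger0_norm //].
by lra.
Qed.

Lemma cos_poly_pi : cos_poly N a pi =
  a 0%N - a 1%N + \sum_(2 <= n < N.+1) (-1) ^+ n * a n.
Proof.
rewrite -[pi]add0r cos_polyDpi /cos_poly big_nat_recl2 //; congr (_ + _).
  by rewrite !mulr0 cos0 expr0 expr1; ring.
by apply: eq_bigr => n _; rewrite mulr0 cos0 mulr1.
Qed.

(** Together, (II) and [f(pi) >= 0] bound the sum of the nonnegative terms [(1 - (-1)^n) a_n] by 0;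
    for odd [n] such a term is [2 a_n]. *)
Lemma admissible_odd n : (2 <= n < N.+1)%N -> odd n -> a n = 0.
Proof.
move=> nN nodd.
have : a n - (-1) ^+ n * a n = 0.
  apply: (@sumr_nat_le0_eq0 _ 2 N.+1 (fun k => a k - (-1) ^+ k * a k)) => // [k kN|].
    have := admissible_ge0 k kN; rewrite -signr_odd; case: odd; rewrite ?expr1 ?expr0; lra.
  case: adm => -[_ _ /(_ pi)] + _ _ _; rewrite cos_poly_pi sumrB.
  by have := admissible_sum_le; lra.
by rewrite -signr_odd nodd expr1; lra.
Qed.

Lemma admissible_signE n : (2 <= n < N.+1)%N -> (-1) ^+ n * a n = a n.
Proof.
move=> nN; rewrite -signr_odd; case nodd: (odd n); last by rewrite mul1r.
by rewrite admissible_odd ?mulr0.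
Qed.

Lemma admissible_sum : a 0%N + \sum_(2 <= n < N.+1) a n = a 1%N.
Proof.
apply/eqP; rewrite eq_le admissible_sum_le /=.
case: adm => -[_ _ /(_ pi)] + _ _ _.
rewrite cos_poly_pi (eq_big_nat _ _ admissible_signE); lra.
Qed.

(** Translating by [pi] moves the zero of [f] to 0 and multiplies [a_n] by [(-1)^n]; the term
    [n = 1] then contributes [- a_1]. *)
Lemma admissible_sum_sqr : \sum_(2 <= n < N.+1) a n * n%:R ^+ 2 <= a 1%N.
Proof.
have : \sum_(0 <= n < N.+1) (-1) ^+ n * a n * n%:R ^+ 2 <= 0.
  apply: cos_poly_min0 => [theta|]; rewrite -cos_polyDpi.
    by case: adm => -[_ _ ->].
  rewrite add0r cos_poly_pi (eq_big_nat _ _ admissible_signE).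
  by have := admissible_sum; lra.
rewrite big_nat_recl2 //.
rewrite (@eq_big_nat _ _ _ _ _ _ (fun n => a n * n%:R ^+ 2)) => [|n nN].
  by rewrite expr1; lra.
by rewrite admissible_signE.
Qed.

(** Four times [admissible_sum] is subtracted from [admissible_sum_sqr]; the factor [4 = 2^2] kills
    the term [n = 2] and leaves the others nonnegative. *)
Lemma admissible_sum_excess_le :
  \sum_(2 <= n < N.+1) a n * (n%:R ^+ 2 - 4) <= 4 * a 0%N - 3 * a 1%N.
Proof.
under eq_bigr do rewrite mulrBr.
rewrite sumrB -mulr_suml.
by have := admissible_sum_sqr; have := admissible_sum; lra.
Qed.

Lemma admissible_excess_ge0 n : (2 <= n < N.+1)%N -> 0 <= a n * (n%:R ^+ 2 - 4).
Proof.
move=> nN; rewrite mulr_ge0 ?admissible_ge0 //.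
have /andP[n2 _] := nN; have : 2 <= n%:R :> R by rewrite ler_nat.
by nra.
Qed.

Lemma admissible_even : ~~ odd N.
Proof.
case: adm => -[_ aN _] _ _ _; apply: contraNN aN => oddN.
by rewrite admissible_odd ?N2 ?ltnSn.
Qed.

Lemma admissible_ratio_ge : 3 / 4 <= a 0%N / a 1%N.
Proof.
case: adm => _ a1 _ _; rewrite ler_pdivlMr //.
have := admissible_sum_excess_le.
have : 0 <= \sum_(2 <= n < N.+1) a n * (n%:R ^+ 2 - 4).
  by rewrite big_nat sumr_ge0 // => n /admissible_excess_ge0.
by lra.
Qed.

Lemma admissible_ratio_eq : a 0%N / a 1%N = 3 / 4 ->
  forall theta, cos_poly N a theta = a 1%N / 4 * classical_poly theta.
Proof.
case: (adm) => -[_ aN _] a1 _ _ ratio theta.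
have a0 : a 0%N = 3 / 4 * a 1%N by rewrite -ratio divfK ?gt_eqF.
have excess0 n : (2 <= n < N.+1)%N -> a n * (n%:R ^+ 2 - 4) = 0.
  move: n; apply: (@sumr_nat_le0_eq0 _ 2 N.+1 (fun n => a n * (n%:R ^+ 2 - 4))).
    exact: admissible_excess_ge0.
  by apply: le_trans admissible_sum_excess_le _; rewrite a0; lra.
(* For [N > 2] the factor [N^2 - 4] is positive, which would force [a N = 0]. *)
have N_eq2 : N = 2%N.
  apply/eqP; rewrite eqn_leq N2 andbT leqNgt; apply: contra aN => N_gt2.
  have : a N * (N%:R ^+ 2 - 4) == 0 by rewrite excess0 ?N2 ?ltnSn.
  rewrite mulf_eq0 => /orP[//|].
  have : 3 <= N%:R :> R by rewrite ler_nat.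
  by move=> N3 /eqP; nra.
(* For [N = 2] this reads [a_0 + a_2 = a_1], whence [a_2 = a_1 / 4]. *)
have := admissible_sum.
rewrite (classical_polyE _ N) // /cos_poly !big_nat_recl2 //.
rewrite N_eq2 !big_nat1 /= a0 => a2.
have -> : a 2%N = a 1%N / 4 by lra.
by field.
Qed.

End Admissible.

(** * Multiples of the classical polynomial *)

Lemma cos_poly_classical_admissible
    (R : realType) (N : nat) (a : nat -> R) (c : R) :
  (2 <= N)%N -> a N != 0 -> 0 < c ->
  (forall theta, cos_poly N a theta = c * classical_poly theta) ->
  admissible N a /\ a 0%N / a 1%N = 3 / 4.
Proof.
move=> N2 aN c0 aE.
have coefE n : (n <= N)%N -> a n = c * [:: 3; 4; 1]`_n.
  move=> nN; apply/eqP; rewrite -subr_eq0; apply/eqP.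
  apply: (@cos_poly_eq0 _ N (fun n => a n - c * [:: 3; 4; 1]`_n)) nN => theta.
  transitivity (cos_poly N a theta - c * classical_poly theta); last first.
    by rewrite aE subrr.
  rewrite (classical_polyE _ N) // /cos_poly mulr_sumr -sumrB.
  by apply: eq_bigr => k _; ring.
(* Beyond index 2 the list yields its default 0, contradicting [a N != 0]. *)
have N_eq2 : N = 2%N.
  apply/eqP; rewrite eqn_leq N2 andbT leqNgt; apply: contra aN => N_gt2.
  by rewrite coefE // nth_default ?mulr0.
move: aN aE coefE; rewrite N_eq2 => aN aE coefE.
have a0 : a 0%N = c * 3 by exact: coefE.
have a1 : a 1%N = c * 4 by exact: coefE.
have a2 : a 2%N = c * 1 by exact: coefE.
split; last by rewrite a0 a1; field; lra.
split; first split => //.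
- by rewrite a0; lra.
- by move=> theta; rewrite aE mulr_ge0 ?classical_poly_ge0 // ltW.
- by rewrite a1; lra.
(* Condition (II) holds with equality: [3c + 4c + c = 2 * 4c]. *)
- rewrite big_nat_recl2 // big_nat1 a0 a1 a2 !ger0_norm; lra.
- by move=> n; rewrite -eqn_leq => /eqP<-; rewrite a2; lra.
Qed.

Theorem theorem1 (R : realType) (N : nat) (a : nat -> R) (hN : (2 <= N)%N) :
  (admissible N a -> ~~ odd N /\ 3 / 4 <= a 0%N / a 1%N)
  /\
  (a N != 0 ->
     (admissible N a /\ a 0%N / a 1%N = 3 / 4
      <->
      exists c : R, 0 < c /\
        forall theta : R, cos_poly N a theta = c * classical_poly theta)).
Proof.
split=> [adm|aN].
  by split; [exact: (admissible_even R N a) | exact: (admissible_ratio_ge R N a)].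
split=> [[adm ratio]|[c [c0]]]; last exact: cos_poly_classical_admissible.
exists (a 1%N / 4); split; last exact: admissible_ratio_eq.
by case: adm => _ a1 _ _; lra.
Qed.
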